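(* Let $\varphi:M\to G$ be an admissible mapping, and let $\mu_\pm,\gamma_\pm$ and $\gamma=\gamma_+^{-1}\eta_-\eta_+^{-1}\gamma_-$ be the local mappings associated with $\varphi$ as in the context. Let $\rho:G\to GL(V)$ be a $\Sigma$-unitary representation of $G$ and let $V_+=\{v\in V\mid\rho(g)v=v\text{ for all }g\in\tilde N_+\}$. Then for any $u,v\in V_+$ $$\langle u,\gamma v\rangle=\langle u,(\mu_+\gamma_+)^{-1}(\mu_-\gamma_-)v\rangle,$$ where for a $G$-valued mapping $\chi$ one denotes $\langle u,\chi v\rangle(p)=\langle u,\rho(\chi(p))v\rangle$.
   Context: $M$ is a one-dimensional complex manifold; all mappings are smooth; products and inverses of $G$-valued mappings are pointwise. $G$ is a connected complex semisimple Lie group with Lie algebra $\mathfrak g$, identified with $T_e^{(1,0)}(G)$; $L_g$ is left translation. $\theta$ is the holomorphic Maurer–Cartan form (the $\mathfrak g$-valued $(1,0)$-form on $G$ with $\theta(x)=L_{g^{-1}*}(x)$ for $x\in T^{(1,0)}_g(G)$), and ${}^\varphi\omega=\varphi^*\theta$. Gradation: $\mathfrak g=\bigoplus_{m\in\mathbb Z}\mathfrak g_m$ is a $\mathbb Z$-gradation, $\tilde{\mathfrak n}_-=\bigoplus_{m<0}\mathfrak g_m$, $\tilde{\mathfrak n}_+=\bigoplus_{m>0}\mathfrak g_m$, $\tilde{\mathfrak h}=\mathfrak g_0$, $\tilde{\mathfrak b}_\pm=\tilde{\mathfrak h}\oplus\tilde{\mathfrak n}_\pm$; $\tilde N_\pm,\tilde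 H,\tilde B_\pm$ are the corresponding connected subgroups. $F_\pm=G/\tilde B_\mp$, with projections $\pi_\pm:G\to F_\pm$, and $\varphi_\pm=\pi_\pm\circ\varphi$. Admissible mappings: fix nonzero $x_\pm\in\mathfrak g_{\pm1}$ and put $\mathcal O_\pm=\mathrm{Ad}(\tilde H)x_\pm$. A mapping $\varphi:M\to G$ is admissible if (i) the $(1,0)$-component of ${}^\varphi\omega$ takes values in $\mathfrak g_{-1}\oplus\mathfrak g_0$ and the $(0,1)$-component in $\mathfrak g_0\oplus\mathfrak g_{+1}$, and (ii) for any $p\in M$, $\varphi_{-*}(\partial_z|_p)\in\pi_{-*}(L_{g*}\mathcal O_-)$ for any $g$ with $\pi_-(g)=\varphi_-(p)$, and $\varphi_{+*}(\partial_{\bar z}|_p)\in\pi_{+*}(L_{g*}\mathcal O_+)$ for any $g$ with $\pi_+(g)=\varphi_+(p)$. Local data: near every point of $M$ there are $g_\pm\in G$ such that $\varphi$ decomposes uniquely as $\varphi=\mu_+\nu_-\eta_-=\mu_-\nu_+\eta_+$ with $\mu_\pm$ valued in $g_\pm\tilde N_\pm$, $\nu_\pm$ in $\tilde N_\pm$, $\eta_\pm$ in $\tilde H$. Then ${}^{\mu_-}\omega=\lambda_-dz$, ${}^{\mu_+}\omega=\lambda_+d\bar z$ with $\lambda_\pm$ valued in $\mathcal O_\pm$, and one chooses locally $\gamma_\pm$ valued in $\tilde H$ with $\lambda_\pm=\sqrt{-1}\,\mathrm{Ad}(\gamma_\pm)x_\pm$, $\gamma_-$ holomorphic and $\gamma_+$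 antiholomorphic. Conjugation: $\sigma$ is an involutive antilinear automorphism of $\mathfrak g$ with $\sigma(\mathfrak g_m)=\mathfrak g_{-m}$ for all $m$, extending to an antiholomorphic automorphism $\Sigma$ of $G$, $\Sigma^2=\mathrm{id}_G$. Put $g^\star=\Sigma(g^{-1})$. A representation $\rho:G\to GL(V)$ in a complex linear space is $\Sigma$-unitary if $V$ is equipped with a hermitian scalar product $\langle\ ,\ \rangle$ such that $\rho(g)^\star=\rho(g^\star)$ for all $g\in G$, where on the left $\star$ is hermitian conjugation with respect to $\langle\ ,\ \rangle$. *)

(* Defs.v *)
From HB Require Import structures.
From mathcomp Require Import all_boot all_order all_algebra.
From mathcomp Require Import sesquilinear complex.
From mathcomp Require Import all_classical all_reals all_analysis.

Set Implicit Arguments.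
Unset Strict Implicit.
Unset Printing Implicit Defensive.
Import Order.TTheory GRing.Theory Num.Theory numFieldNormedType.Exports.
Local Open Scope classical_set_scope.
Local Open Scope ring_scope.

(* Naming the structure [numClosedFieldType] is what makes MathComp-Analysis'
   topology and norm on numerical fields available on R[i]. *)
Definition C (R : realType) : numClosedFieldType := complex R.

(* F is of class C^k on the open set W, over the scalar field K.  The iterated
   derivatives are taken over K: for K = R this is real C^k-smoothness, while
   for K = C already the case k = 1 is holomorphy, and all k are equivalent. *)
Fixpoint Ck (K : numFieldType) (U V : normedModType K) (k : nat)
    (W : set U) (F : U -> V) : Prop :=
  if k is k'.+1 then
    (forall x, W x -> differentiable F x) /\ (forall v, Ck k' W ('D_v F))
  else forall x, W x -> {for x, continuous F}.

Definition Cinfty (K : numFieldType) (U V : normedModType K)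
    (W : set U) (F : U -> V) : Prop := forall k, Ck k W F.

Definition conjv (R : realType) (n : nat) (w : 'rV[C R]_n) : 'rV[C R]_n :=
  map_mx Num.conj w.

(* The identification of C^n with R^(2n), w |-> (Re w, Im w). *)
Definition to_real (R : realType) (n : nat) (w : 'rV[C R]_n) : 'rV[R]_(n + n) :=
  row_mx (map_mx (@complex.Re R) w) (map_mx (@complex.Im R) w).

Definition of_real (R : realType) (n : nat) (x : 'rV[R]_(n + n)) : 'rV[C R]_n :=
  \row_j Complex (lsubmx x 0 j) (rsubmx x 0 j).

(* [coord] and [param] are only meaningful on [dom] and on [coord @` dom]. *)
Record chart (R : realType) (n : nat) (X : topologicalType) := Chart {
  dom : set X;
  coord :> X -> 'rV[C R]_n;
  param : 'rV[C R]_n -> X;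
  dom_open : open dom;
  im_open : open (coord @` dom);
  coordK : forall p, dom p -> param (coord p) = p;
  coord_continuous : forall p, dom p -> {for p, continuous coord};
  param_continuous :
    forall w, (coord @` dom) w -> {for w, continuous param} }.

Definition holo_transition (R : realType) (n : nat) (X : topologicalType)
    (c c' : chart R n X) : Prop :=
  Cinfty (c @` (dom c `&` dom c')) (c' \o param c).

HB.mixin Record isComplexManifold (R : realType) (n : nat) X
    of Topological X := {
  chart_at : X -> chart R n X;
  chart_at_dom : forall p : X, dom (chart_at p) p;
  chart_at_transition :
    forall p q : X, holo_transition (chart_at p) (chart_at q);
  manifold_hausdorff : hausdorff_space X;
  manifold_second_countable : @second_countable X }.

#[short(type="complexManifoldType")]
HB.structure Definition ComplexManifold (R : realType) (n : nat) :=
  {X of Topological X & isComplexManifold R n X}.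

(* A chart of the maximal atlas. *)
Definition local_coordinates (R : realType) (n : nat)
    (X : complexManifoldType R n) (c : chart R n X) : Prop :=
  forall p : X, holo_transition c (chart_at p) /\ holo_transition (chart_at p) c.

(* The expression of f in the charts attached to p and f p. *)
Definition in_charts (R : realType) (n m : nat) (X : complexManifoldType R n)
    (Y : complexManifoldType R m) (f : X -> Y) (p : X) :
    'rV[C R]_n -> 'rV[C R]_m :=
  chart_at (f p) \o f \o param (chart_at p).

Definition holo_at (R : realType) (n m : nat) (X : complexManifoldType R n)
    (Y : complexManifoldType R m) (f : X -> Y) (p : X) : Prop :=
  {for p, continuous f} /\
  exists2 W, open_nbhs (chart_at p p) W & Cinfty W (in_charts f p).

Definition antiholo_at (R : realType) (n m : nat) (X : complexManifoldType R n)
    (Y : complexManifoldType R m) (f : X -> Y) (p : X) : Prop :=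
  {for p, continuous f} /\
  exists2 W, open_nbhs (chart_at p p) W
           & Cinfty W (@conjv R m \o in_charts f p).

Definition smooth_at (R : realType) (n m : nat) (X : complexManifoldType R n)
    (Y : complexManifoldType R m) (f : X -> Y) (p : X) : Prop :=
  {for p, continuous f} /\
  exists2 W, open_nbhs (to_real (chart_at p p)) W
           & Cinfty W (@to_real R m \o in_charts f p \o @of_real R n).

(* Joint holomorphy of a map of two variables. *)
Definition holo2_at (R : realType) (n m k : nat) (X : complexManifoldType R n)
    (Y : complexManifoldType R m) (Z : complexManifoldType R k)
    (f : X -> Y -> Z) (p : X) (q : Y) : Prop :=
  {for (p, q), continuous (fun x : X * Y => f x.1 x.2)} /\
  exists2 W : set ('rV[C R]_n * 'rV[C R]_m),
    open_nbhs (chart_at p p, chart_at q q) W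
    & Cinfty W (fun w : 'rV[C R]_n * 'rV[C R]_m =>
        chart_at (f p q) (f (param (chart_at p) w.1) (param (chart_at q) w.2))).

(* The holomorphic tangent space T^(1,0)_p X is represented by 'rV[C R]_n,
   through the coordinate frame d/dzeta_1, ..., d/dzeta_n of [chart_at p]; it is
   also the real tangent space with its complex structure, by v |-> 2 Re v. *)
Definition mdiff (R : realType) (n m : nat) (X : complexManifoldType R n)
    (Y : complexManifoldType R m) (f : X -> Y) (p : X) :
    'rV[C R]_n -> 'rV[C R]_m :=
  'd (in_charts f p) (chart_at p p).

(* The (antilinear) real differential of an antiholomorphic map. *)
Definition amdiff (R : realType) (n m : nat) (X : complexManifoldType R n)
    (Y : complexManifoldType R m) (f : X -> Y) (p : X) (v : 'rV[C R]_n) :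
    'rV[C R]_m :=
  conjv ('d (@conjv R m \o in_charts f p) (chart_at p p) v).

Definition real_derive (R : realType) (n m : nat)
    (F : 'rV[C R]_n -> 'rV[C R]_m) (w v : 'rV[C R]_n) : 'rV[C R]_m :=
  of_real ('D_(to_real v) (@to_real R m \o F \o @of_real R n) (to_real w)).

Definition wirtinger_z (R : realType) (m : nat) (F : 'rV[C R]_1 -> 'rV[C R]_m)
    (w : 'rV[C R]_1) : 'rV[C R]_m :=
  2^-1 *: (real_derive F w (const_mx 1) - 'i *: real_derive F w (const_mx 'i)).

Definition wirtinger_zbar (R : realType) (m : nat)
    (F : 'rV[C R]_1 -> 'rV[C R]_m) (w : 'rV[C R]_1) : 'rV[C R]_m :=
  2^-1 *: (real_derive F w (const_mx 1) + 'i *: real_derive F w (const_mx 'i)).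

(* The complexified tangent space is T^(1,0) (+) T^(0,1), with frames d/dzeta_j
   and d/dzetabar_j; a complexified tangent vector is the pair of its
   components, i.e. of its values on the zeta_j and on the zetabar_j. *)
Definition push_z (R : realType) (m : nat) (M : complexManifoldType R 1)
    (Y : complexManifoldType R m) (z : chart R 1 M) (f : M -> Y) (p : M) :
    'rV[C R]_m * 'rV[C R]_m :=
  let F := chart_at (f p) \o f \o param z in
  (wirtinger_z F (z p), wirtinger_z (@conjv R m \o F) (z p)).

Definition push_zbar (R : realType) (m : nat) (M : complexManifoldType R 1)
    (Y : complexManifoldType R m) (z : chart R 1 M) (f : M -> Y) (p : M) :
    'rV[C R]_m * 'rV[C R]_m :=
  let F := chart_at (f p) \o f \o param z in
  (wirtinger_zbar F (z p), wirtinger_zbar (@conjv R m \o F) (z p)).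

HB.mixin Record isComplexLieGroup (R : realType) (n : nat) G
    of ComplexManifold R n G & Group G := {
  mulg_holo : forall g h : G, holo2_at (fun x y : G => (x * y)%g) g h;
  invg_holo : forall g : G, holo_at (fun x : G => (x^-1)%g) g }.

#[short(type="complexLieGroupType")]
HB.structure Definition ComplexLieGroup (R : realType) (n : nat) :=
  {G of ComplexManifold R n G & Group G & isComplexLieGroup R n G}.

Definition ltrans (R : realType) (n : nat) (G : complexLieGroupType R n)
    (g h : G) : G := (g * h)%g.

(* The Lie algebra of G is T^(1,0)_1 G, that is 'rV[C R]_n. *)
Definition Ad (R : realType) (n : nat) (G : complexLieGroupType R n) (g : G) :
    'rV[C R]_n -> 'rV[C R]_n :=
  mdiff (fun h : G => (g * h * g^-1)%g) 1%g.

(* [X, Y] = (ad X) Y, where ad is the differential of Ad at the unit. *)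
Definition bracket (R : realType) (n : nat) (G : complexLieGroupType R n)
    (X Y : 'rV[C R]_n) : 'rV[C R]_n :=
  'd (fun w : 'rV[C R]_n => Ad (param (chart_at (1%g : G)) w) Y)
     (chart_at (1%g : G) 1%g) X.

Definition lie_ideal (R : realType) (n : nat) (G : complexLieGroupType R n)
    (I : {vspace 'rV[C R]_n}) : Prop :=
  forall X Y, Y \in I -> bracket G X Y \in I.

Definition derived (R : realType) (n : nat) (G : complexLieGroupType R n)
    (I : {vspace 'rV[C R]_n}) : {vspace 'rV[C R]_n} :=
  <<[seq bracket G X Y | X <- vbasis I, Y <- vbasis I]>>%VS.

Definition solvable_lie (R : realType) (n : nat) (G : complexLieGroupType R n)
    (I : {vspace 'rV[C R]_n}) : Prop :=
  exists k, iter k (derived G) I = 0%VS.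

Definition semisimple (R : realType) (n : nat) (G : complexLieGroupType R n) :
    Prop :=
  forall I, lie_ideal G I -> solvable_lie G I -> I = 0%VS.

(* g = exp X, i.e. g = c 1 for the complex one-parameter subgroup c of G with
   initial velocity X. *)
Definition is_exp (R : realType) (n : nat) (G : complexLieGroupType R n)
    (X : 'rV[C R]_n) (g : G) : Prop :=
  exists c : C R -> G,
    [/\ forall s t, c (s + t) = (c s * c t)%g,
        continuous c,
        is_derive (0 : C R) 1 (chart_at (1%g : G) \o c) X
      & c 1 = g].

(* The connected Lie subgroup of G with Lie algebra s: it is the subgroup
   generated by exp s. *)
Inductive connected_subgroup (R : realType) (n : nat)
    (G : complexLieGroupType R n) (s : {vspace 'rV[C R]_n}) : set G :=
| Sub_exp X g : X \in s -> is_exp X g -> connected_subgroup s g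
| Sub_one : connected_subgroup s 1%g
| Sub_mul g h : connected_subgroup s g -> connected_subgroup s h ->
    connected_subgroup s (g * h)%g
| Sub_inv g : connected_subgroup s g -> connected_subgroup s (g^-1)%g.

(* The complex manifold F, with projection pi, is the quotient G / S: this
   determines F and pi up to a unique isomorphism. *)
Record is_quotient (R : realType) (n k : nat) (G : complexLieGroupType R n)
    (S : set G) (F : complexManifoldType R k) (pi : G -> F) : Prop := {
  quotient_surj : forall q, exists g, pi g = q;
  quotient_fiber : forall g h, pi g = pi h <-> S (g^-1 * h)%g;
  quotient_holo : forall g, holo_at pi g;
  quotient_submersion : forall g w, exists v, mdiff pi g v = w }.

(* The Maurer-Cartan form, on complexified tangent vectors: being of type (1,0),
   it vanishes on the (0,1)-component. *)
Definition maurer_cartan (R : realType) (n : nat) (G : complexLieGroupType R n)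
    (g : G) (v : 'rV[C R]_n * 'rV[C R]_n) : 'rV[C R]_n :=
  mdiff (ltrans (g^-1)%g) g v.1.

(* The pulled back form f^* theta = (mc_z f) dz + (mc_zbar f) dzbar. *)
Definition mc_z (R : realType) (n : nat) (G : complexLieGroupType R n)
    (M : complexManifoldType R 1) (z : chart R 1 M) (f : M -> G) (p : M) :
    'rV[C R]_n :=
  maurer_cartan (f p) (push_z z f p).

Definition mc_zbar (R : realType) (n : nat) (G : complexLieGroupType R n)
    (M : complexManifoldType R 1) (z : chart R 1 M) (f : M -> G) (p : M) :
    'rV[C R]_n :=
  maurer_cartan (f p) (push_zbar z f p).

(* The Lie algebra is finite dimensional, so the degrees of a gradation lie in
   some interval [-gr_bound, gr_bound]. *)
Record gradation (R : realType) (n : nat) (G : complexLieGroupType R n) :=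
  Gradation {
  gr :> int -> {vspace 'rV[C R]_n};
  gr_bound : nat;
  gr_out : forall m : int, gr_bound%:Z < `|m| -> gr m = 0%VS;
  gr_direct :
    directv (\sum_(i < gr_bound.*2.+1) gr (i%:Z - gr_bound%:Z))%VS;
  gr_full :
    (\sum_(i < gr_bound.*2.+1) gr (i%:Z - gr_bound%:Z))%VS = fullv;
  gr_bracket : forall (k l : int) X Y,
    X \in gr k -> Y \in gr l -> bracket G X Y \in gr (k + l) }.

Definition n_minus (R : realType) (n : nat) (G : complexLieGroupType R n)
    (d : gradation G) : {vspace 'rV[C R]_n} :=
  (\sum_(i < gr_bound d) d (- (i.+1)%:Z))%VS.

Definition n_plus (R : realType) (n : nat) (G : complexLieGroupType R n)
    (d : gradation G) : {vspace 'rV[C R]_n} :=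
  (\sum_(i < gr_bound d) d (i.+1)%:Z)%VS.

Definition N_minus (R : realType) (n : nat) (G : complexLieGroupType R n)
    (d : gradation G) : set G := connected_subgroup (n_minus d).

Definition N_plus (R : realType) (n : nat) (G : complexLieGroupType R n)
    (d : gradation G) : set G := connected_subgroup (n_plus d).

Definition H_zero (R : realType) (n : nat) (G : complexLieGroupType R n)
    (d : gradation G) : set G := connected_subgroup (d 0).

Definition B_minus (R : realType) (n : nat) (G : complexLieGroupType R n)
    (d : gradation G) : set G := connected_subgroup (d 0%R + n_minus d)%VS.

Definition B_plus (R : realType) (n : nat) (G : complexLieGroupType R n)
    (d : gradation G) : set G := connected_subgroup (d 0%R + n_plus d)%VS.

Definition orbit (R : realType) (n : nat) (G : complexLieGroupType R n)
    (d : gradation G) (x : 'rV[C R]_n) : set 'rV[C R]_n :=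
  [set Ad h x | h in H_zero d].

Record admissible (R : realType) (n km kp : nat) (G : complexLieGroupType R n)
    (d : gradation G) (xm xp : 'rV[C R]_n)
    (Fm : complexManifoldType R km) (Fp : complexManifoldType R kp)
    (pim : G -> Fm) (pip : G -> Fp)
    (M : complexManifoldType R 1) (phi : M -> G) : Prop := {
  adm_smooth : forall p, smooth_at phi p;
  adm_form : forall z : chart R 1 M, local_coordinates z ->
    forall p, dom z p ->
      mc_z z phi p \in (d (-1)%R + d 0%R)%VS /\
      mc_zbar z phi p \in (d 0%R + d 1%R)%VS;
  adm_minus : forall z : chart R 1 M, local_coordinates z ->
    forall p, dom z p -> forall g, pim g = pim (phi p) ->
      exists2 x, orbit d xm x
        & push_z z (pim \o phi) p = (mdiff pim g (mdiff (ltrans g) 1%g x), 0);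
  adm_plus : forall z : chart R 1 M, local_coordinates z ->
    forall p, dom z p -> forall g, pip g = pip (phi p) ->
      exists2 x, orbit d xp x
        & push_zbar z (pip \o phi) p
            = (mdiff pip g (mdiff (ltrans g) 1%g x), 0) }.

(* The local mappings attached to phi, on the domain of the coordinate z.  They
   are total functions, constrained on [dom z] only. *)
Record local_data (R : realType) (n : nat) (G : complexLieGroupType R n)
    (d : gradation G) (xm xp : 'rV[C R]_n) (M : complexManifoldType R 1)
    (phi : M -> G) (z : chart R 1 M) (gm gp : G)
    (mum mup num nup etam etap gamm gamp : M -> G) : Prop := {
  loc_coord : local_coordinates z;
  loc_smooth : forall p, dom z p ->
    [/\ smooth_at mum p /\ smooth_at mup p,
        smooth_at num p /\ smooth_at nup p
      & smooth_at etam p /\ smooth_at etap p];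
  loc_mu : forall p, dom z p ->
    N_minus d (gm^-1 * mum p)%g /\ N_plus d (gp^-1 * mup p)%g;
  loc_nu : forall p, dom z p -> N_minus d (num p) /\ N_plus d (nup p);
  loc_eta : forall p, dom z p -> H_zero d (etam p) /\ H_zero d (etap p);
  loc_decomp : forall p, dom z p ->
    phi p = (mup p * num p * etam p)%g /\ phi p = (mum p * nup p * etap p)%g;
  loc_gamma : forall p, dom z p -> H_zero d (gamm p) /\ H_zero d (gamp p);
  loc_gamma_holo : forall p, dom z p ->
    holo_at gamm p /\ antiholo_at gamp p;
  loc_form_minus : forall p, dom z p ->
    mc_z z mum p = 'i *: Ad (gamm p) xm /\ mc_zbar z mum p = 0;
  loc_form_plus : forall p, dom z p ->
    mc_zbar z mup p = 'i *: Ad (gamp p) xp /\ mc_z z mup p = 0;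
  loc_lambda : forall p, dom z p ->
    orbit d xm (mc_z z mum p) /\ orbit d xp (mc_zbar z mup p) }.

Record is_conjugation (R : realType) (n : nat) (G : complexLieGroupType R n)
    (d : gradation G) (sigma : 'rV[C R]_n -> 'rV[C R]_n) (Sigma : G -> G) :
    Prop := {
  sigma_antilinear : forall (a : C R) X Y,
    sigma (a *: X + Y) = Num.conj a *: sigma X + sigma Y;
  sigma_bracket : forall X Y,
    sigma (bracket G X Y) = bracket G (sigma X) (sigma Y);
  sigmaK : involutive sigma;
  sigma_gr : forall m : int,
    sigma @` [set X | X \in d m] = [set X | X \in d (- m)];
  Sigma_mul : forall g h, Sigma (g * h)%g = (Sigma g * Sigma h)%g;
  Sigma_antiholo : forall g, antiholo_at Sigma g;
  SigmaK : involutive Sigma;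
  Sigma_sigma : forall X, amdiff Sigma 1%g X = sigma X }.

Definition star (R : realType) (n : nat) (G : complexLieGroupType R n)
    (Sigma : G -> G) (g : G) : G := Sigma (g^-1)%g.

Definition representation (R : realType) (n : nat)
    (G : complexLieGroupType R n) (V : lmodType (C R))
    (rho : G -> {linear V -> V}) : Prop :=
  (forall v, rho 1%g v = v) /\
  (forall g h v, rho (g * h)%g v = rho g (rho h v)).

(* rho (star g) is the hermitian adjoint of rho g.  [form] is a positive
   definite hermitian form, linear in its first argument. *)
Definition Sigma_unitary (R : realType) (n : nat) (G : complexLieGroupType R n)
    (Sigma : G -> G) (V : lmodType (C R)) (form : {dot V for (@Num.conj (C R))})
    (rho : G -> {linear V -> V}) : Prop :=
  forall g u v, form (rho (star Sigma g) u) v = form u (rho g v).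

Definition V_plus (R : realType) (n : nat) (G : complexLieGroupType R n)
    (d : gradation G) (V : lmodType (C R)) (rho : G -> {linear V -> V}) :
    set V :=
  [set v | forall g, N_plus d g -> rho g v = v].

(* Main.v *)
(* From [phi = mu_+ nu_- eta_- = mu_- nu_+ eta_+] one gets
     (mu_+ gamma_+)^-1 (mu_- gamma_-)
       = (gamma_+^-1 nu_- gamma_+) gamma (gamma_-^-1 nu_+^-1 gamma_-).
   The outer factors lie in N_- and N_+, since H normalizes both.  The right one
   fixes v, and the left one, moved to the other side of the form, becomes an
   element of Sigma(N_-) = N_+, which fixes u.

   The subgroups being generated by one-parameter subgroups, everything reduces
   to [h exp(X) h^-1 = exp(Ad(h) X)], [Sigma(exp X) = exp(sigma X)] and to the
   stability of n_+ and n_- under Ad(exp X) for X of degree 0.  The latter is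
   obtained from [t |-> Ad(exp tX)] being a one-parameter group of matrices with
   derivative ad X at 0. *)
Require Import Defs.
From HB Require Import structures.
From mathcomp Require Import all_boot all_order all_algebra.
From mathcomp Require Import sesquilinear complex.
From mathcomp Require Import all_classical all_reals all_analysis.
From mathcomp Require Import ring lra.

Set Implicit Arguments.
Unset Strict Implicit.
Unset Printing Implicit Defensive.
Import Order.TTheory GRing.Theory Num.Theory numFieldNormedType.Exports.
Local Open Scope classical_set_scope.
Local Open Scope ring_scope.

(** * One-parameter groups of matrices *)

(** The norm on [C R] takes values in [C R] itself. This modulus lies in [R], where real arithmetic
    and the Archimedean property apply. *)
Definition cabs (R : realType) (x : C R) : R := complex.Re `|x|.

Lemma cabsE (R : realType) (x : C R) : `|x| = (cabs x)%:C%C.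
Proof. by apply/esym/RRe_real/normr_real. Qed.

Lemma cabs_ge0 (R : realType) (x : C R) : 0 <= cabs x.
Proof. by rewrite -lecR -cabsE normr_ge0. Qed.

Lemma cabs_eq0 (R : realType) (x : C R) : (cabs x == 0) = (x == 0).
Proof. by rewrite -[RHS]normr_eq0 cabsE -(inj_eq (@complexI R)). Qed.

Lemma cabsM (R : realType) (x y : C R) : cabs (x * y) = cabs x * cabs y.
Proof. by apply: (@complexI R); rewrite rmorphM -!cabsE normrM. Qed.

Lemma cabsD (R : realType) (x y : C R) : cabs (x + y) <= cabs x + cabs y.
Proof. by rewrite -lecR rmorphD -!cabsE ler_normD. Qed.

Lemma cabs_nat (R : realType) k : cabs (k%:R : C R) = k%:R.
Proof. by apply: (@complexI R); rewrite -cabsE normr_nat rmorph_nat. Qed.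

(** The entrywise l1 norm, chosen because it is submultiplicative for rectangular matrices. *)
Definition mxnorm1 (R : realType) m n (A : 'M[C R]_(m, n)) : R :=
  \sum_i \sum_j cabs (A i j).

Lemma mxnorm1_ge0 (R : realType) m n (A : 'M[C R]_(m, n)) : 0 <= mxnorm1 A.
Proof. by apply/sumr_ge0=> i _; apply/sumr_ge0=> j _; apply: cabs_ge0. Qed.

Lemma mxnorm1_eq0 (R : realType) m n (A : 'M[C R]_(m, n)) :
  mxnorm1 A = 0 -> A = 0.
Proof.
move=> A0; apply/matrixP=> i j; rewrite mxE; apply/eqP; rewrite -cabs_eq0.
have row0 k : 0 <= \sum_l cabs (A k l).
  by apply/sumr_ge0=> l _; apply: cabs_ge0.
have /(_ i isT)/eqP Ai0 := psumr_eq0P (fun k _ => row0 k) A0.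
by apply/eqP/(psumr_eq0P _ (eqP Ai0)) => // l _; apply: cabs_ge0.
Qed.

Lemma mxnorm1D (R : realType) m n (A B : 'M[C R]_(m, n)) :
  mxnorm1 (A + B) <= mxnorm1 A + mxnorm1 B.
Proof.
rewrite /mxnorm1 -big_split; apply: ler_sum => i _ /=.
by rewrite -big_split; apply: ler_sum => j _ /=; rewrite mxE cabsD.
Qed.

Lemma mxnorm1Z (R : realType) m n a (A : 'M[C R]_(m, n)) :
  mxnorm1 (a *: A) = cabs a * mxnorm1 A.
Proof.
rewrite /mxnorm1 mulr_sumr; apply: eq_bigr => i _; rewrite mulr_sumr.
by apply: eq_bigr => j _; rewrite mxE cabsM.
Qed.

Lemma cabs_sum (R : realType) (I : finType) (F : I -> C R) :
  cabs (\sum_i F i) <= \sum_i cabs (F i).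
Proof.
elim/big_ind2: _ => // [|x a y b xa yb].
  by rewrite le_eqVlt cabs_eq0 eqxx.
exact: le_trans (cabsD _ _) (lerD xa yb).
Qed.

(** After the triangle inequality and an exchange of sums, each [cabs (A i j)] multiplies the sum of
    row [j] of [B], which is at most [mxnorm1 B]. *)
Lemma mxnorm1M (R : realType) m n k (A : 'M[C R]_(m, n)) (B : 'M[C R]_(n, k)) :
  mxnorm1 (A *m B) <= mxnorm1 A * mxnorm1 B.
Proof.
rewrite /mxnorm1 mulr_suml; apply: ler_sum => i _.
rewrite mulr_suml.
apply: (@le_trans _ _ (\sum_l \sum_j cabs (A i j) * cabs (B j l))).
  apply: ler_sum => l _; rewrite mxE; apply: (le_trans (cabs_sum _)).
  by apply: ler_sum => j _; rewrite cabsM.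
rewrite exchange_big; apply: ler_sum => j _ /=; rewrite -mulr_sumr.
apply: ler_wpM2l; first exact: cabs_ge0.
rewrite [leRHS](bigD1 j) //= lerDl; apply: sumr_ge0 => a _.
by apply: sumr_ge0 => b _; apply: cabs_ge0.
Qed.

(** A converse Bernoulli bound: in the induction the extra term [2 * k * x ^ 2] is at most [x]. It
    keeps the factor accumulated over [k] steps below 2. *)
Lemma expr1D_le (R : realFieldType) (x : R) k :
  0 <= x -> 2 * k%:R * x <= 1 -> (1 + x) ^+ k <= 1 + 2 * k%:R * x.
Proof.
move=> x0; elim: k => [|k IHk] kx; first by rewrite mulr0 mul0r addr0.
have k1E : k.+1%:R = k%:R + 1 :> R by rewrite -natr1.
have k0 : 0 <= k%:R :> R by [].
have xk0 : 0 <= k%:R * x by rewrite mulr_ge0.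
have /IHk H : 2 * k%:R * x <= 1 by rewrite k1E in kx; lra.
rewrite exprSr k1E; rewrite k1E in kx.
apply: le_trans (_ : (1 + 2 * k%:R * x) * (1 + x) <= _).
  by apply: ler_wpM2r H; lra.
by nra.
Qed.

(** The expansion [A t = 1 + t B + o(t)] with real epsilons, the form needed for estimates over
    finitely many steps. The value [A 0] is built in as the identity. *)
Definition derivative_at0 (R : realType) n (A : C R -> 'M[C R]_n) (B : 'M[C R]_n) :=
  forall eps : R, 0 < eps -> exists2 delta : R, 0 < delta &
    forall t, cabs t < delta ->
      mxnorm1 (A t - 1%:M - t *: B) <= eps * cabs t.

(* The Euler polygon estimate: [A h] maps [U] into itself up to [eps * h], and
   [k] such steps of size [t / k] accumulate, up to a constant factor, an error
   of at most [eps * t * (1 + K * t / k) ^ k], whatever [eps] is. *)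
Lemma one_parameter_stable_small (R : realType) n m (A : C R -> 'M[C R]_n)
    (B : 'M[C R]_n) (D : 'M[C R]_m) (U : 'M[C R]_(m, n)) (t : C R) :
  (forall s t, A (s + t) = A s *m A t) -> A 0 = 1%:M ->
  derivative_at0 A B -> U *m B = D *m U ->
  2 * (mxnorm1 B + mxnorm1 D + 1) * cabs t <= 1 -> (U *m A t <= U)%MS.
Proof.
move=> AD A0 A'0 UB tK.
(* The extra 1 beside [mxnorm1 B] leaves room for the one-step error, whose norm is at most [cabs h]
   because [eps <= 1]. *)
have [K [KB KD K1 {}tK]] : exists K, [/\ mxnorm1 B + 1 <= K, mxnorm1 D <= K, 1 <= K
    & 2 * K * cabs t <= 1].
  exists (mxnorm1 B + mxnorm1 D + 1).
  by have := mxnorm1_ge0 B; have := mxnorm1_ge0 D; split => //; lra.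
(* The inclusion says that [U *m A t] vanishes modulo [U], that is after multiplication by the
   cokernel [P]. It suffices to make this product arbitrarily small. *)
rewrite submxE; set P := cokermx U; apply/eqP/mxnorm1_eq0/eqP.
rewrite eq_le mxnorm1_ge0 andbT.
have [c c0 cE] : exists2 c, 0 <= c & c = mxnorm1 U * mxnorm1 P.
  by eexists; last reflexivity; apply: mulr_ge0; apply: mxnorm1_ge0.
have t0 := cabs_ge0 t.
suff key eps : 0 < eps -> eps <= 1 -> mxnorm1 (U *m A t *m P) <= eps * (2 * c * cabs t).
  have X0 : 0 <= 2 * c * cabs t by apply: mulr_ge0 => //; apply: mulr_ge0.
  rewrite leNgt; apply/negP => Y0.
  set Y := mxnorm1 _ in key Y0; set X := 2 * c * cabs t in key X0.
  (* For this value of [eps] the bound [Y <= eps * X] gives [Y * (Y + 2 * X + 1) <= Y * X],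
     impossible for [Y > 0]. *)
  have e0 : 0 < Y / (Y + X + X + 1) by apply: divr_gt0; lra.
  have e1 : Y / (Y + X + X + 1) <= 1 by rewrite ler_pdivrMr; lra.
  have := key _ e0 e1.
  rewrite mulrAC ler_pdivlMr; last lra.
  by nra.
move=> e0 e1; have [delta d0 Hd] := A'0 _ e0.
(* Enough steps are taken for the step size [t / k.+1] to fall below [delta]. *)
have [k kt] : exists k : nat, cabs t < k.+1%:R * delta.
  have /Num.Theory.archi_boundP : 0 <= cabs t / delta by rewrite divr_ge0 // ltW.
  set b := Num.bound _ => tb; exists b; rewrite -ltr_pdivrMr //.
  by apply: lt_trans tb _; rewrite ltr_nat.
set h := t / k.+1%:R.
have th : t = k.+1%:R * h by rewrite mulrC divfK // pnatr_eq0.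
have ch : cabs t = k.+1%:R * cabs h by rewrite th cabsM cabs_nat.
have h0 := cabs_ge0 h.
have Kh0 : 0 <= K * cabs h by apply: mulr_ge0 => //; apply: le_trans K1.
have hd : cabs h < delta by rewrite -(ltr_pM2l (_ : 0 < k.+1%:R)) // -ch.
set E := A h - 1%:M - h *: B.
have nE : mxnorm1 E <= eps * cabs h by apply: Hd.
have Ah : A h = 1%:M + h *: B + E by apply/eqP; rewrite addrC -subr_eq opprD addrA.
have Akh j : A (j.+1%:R * h) = A h *m A (j%:R * h).
  by rewrite -AD -add1n natrD mulrDl mul1r.
(* The error [E] of one step gets multiplied by the remaining steps; this bounds their growth. *)
have nA j : mxnorm1 (A (j%:R * h) *m P) <= mxnorm1 P * (1 + K * cabs h) ^+ j.
  elim: j => [|j IHj]; first by rewrite mul0r A0 mul1mx expr0 mulr1.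
  rewrite Akh -mulmxA; set Z := _ *m P in IHj *.
  rewrite Ah -addrA mulmxDl mul1mx.
  apply: (le_trans (mxnorm1D _ _)).
  have Z0 := mxnorm1_ge0 Z.
  have H1 : mxnorm1 ((h *: B + E) *m Z) <= K * cabs h * mxnorm1 Z.
    apply: le_trans (mxnorm1M _ _) _; apply: ler_wpM2r => //.
    apply: le_trans (mxnorm1D _ _) _; rewrite mxnorm1Z.
    apply: le_trans (lerD (lexx _) nE) _; rewrite [cabs h * _]mulrC -mulrDl.
    by apply: ler_wpM2r => //; apply: le_trans KB; rewrite lerD2l.
  rewrite exprS mulrCA.
  apply: le_trans (_ : (1 + K * cabs h) * mxnorm1 Z <= _).
    by rewrite mulrDl mul1r lerD2l.
  by apply: ler_wpM2l IHj; rewrite addr_ge0.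
(* Since [U *m B = D *m U], one has [U *m A h = (1%:M + h *: D) *m U + U *m E]. The first term
   multiplies the previous defect by at most [1 + K * cabs h], the second adds one new error. *)
have nf j : mxnorm1 (U *m A (j%:R * h) *m P) <=
    j%:R * (eps * cabs h * c) * (1 + K * cabs h) ^+ j.
  elim: j => [|j IHj].
    rewrite mul0r A0 mulmx1 mulmx_coker !mul0r /mxnorm1 big1 // => i _.
    by rewrite big1 // => l _; rewrite mxE; apply/eqP; rewrite cabs_eq0.
  rewrite Akh mulmxA Ah 2!mulmxDr mulmx1 -scalemxAr UB scalemxAl -{1}[U]mul1mx -mulmxDl.
  rewrite 2!mulmxDl -!mulmxA.
  move: IHj (nA j); rewrite -!mulmxA; set Z := A _ *m P => IHj nZ.
  apply: le_trans (mxnorm1D _ _) _.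
  have q1 : 1 <= 1 + K * cabs h by rewrite lerDl.
  have [q qE] : exists q, q = 1 + K * cabs h by eexists.
  rewrite -qE in q1 nZ IHj *; have q0 : 0 <= q by apply: le_trans q1.
  have qj0 : 0 <= q ^+ j by apply: exprn_ge0.
  have H2 : mxnorm1 (U *m (E *m Z)) <= (eps * cabs h * c) * q ^+ j.
    apply: le_trans (mxnorm1M _ _) _.
    have := mxnorm1_ge0 U; have := mxnorm1_ge0 P; have := mxnorm1_ge0 Z.
    have := mxnorm1_ge0 E => hE hZ hP hU.
    have hEZ : mxnorm1 (E *m Z) <= (eps * cabs h) * (mxnorm1 P * q ^+ j).
      by apply: le_trans (mxnorm1M _ _) _; apply: ler_pM.
    apply: le_trans (ler_wpM2l hU hEZ) _.
    by rewrite cE le_eqVlt; apply/orP; left; apply/eqP; ring.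
  have H1 : mxnorm1 ((1%:M + h *: D) *m (U *m Z)) <= q * mxnorm1 (U *m Z).
    have UZ0 := mxnorm1_ge0 (U *m Z).
    rewrite mulmxDl mul1mx; apply: le_trans (mxnorm1D _ _) _.
    have : mxnorm1 (h *: D *m (U *m Z)) <= cabs h * mxnorm1 D * mxnorm1 (U *m Z).
      by rewrite -mxnorm1Z mxnorm1M.
    have : cabs h * mxnorm1 D * mxnorm1 (U *m Z) <= K * cabs h * mxnorm1 (U *m Z).
      by apply: ler_wpM2r => //; rewrite mulrC; apply: ler_wpM2r.
    by move=> X Y; rewrite qE mulrDl mul1r lerD2l; apply: le_trans Y X.
  have H3 := ler_wpM2l q0 IHj.
  have w0 : 0 <= eps * cabs h * c * q ^+ j.
    by apply: mulr_ge0 => //; apply: mulr_ge0 => //; apply: mulr_ge0 => //; apply: ltW.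
  have H4 : eps * cabs h * c * q ^+ j <= q * (eps * cabs h * c * q ^+ j).
    by rewrite ler_peMl.
  apply: le_trans (lerD (le_trans H1 H3) H2) _.
  apply: le_trans (lerD (lexx _) H4) _; rewrite exprS -natr1.
  by rewrite le_eqVlt; apply/orP; left; apply/eqP; ring.
have := nf k.+1; rewrite -th => /le_trans; apply.
have -> : eps * (2 * c * cabs t) = k.+1%:R * (eps * cabs h * c) * 2.
  by rewrite ch; ring.
(* The smallness of [t] bounds the accumulated factor by 2 whatever the number of steps. *)
have Kh2 : 2 * k.+1%:R * (K * cabs h) <= 1.
  by apply: le_trans tK; rewrite ch le_eqVlt; apply/orP; left; apply/eqP; ring.
apply: ler_wpM2l; last by have := expr1D_le Kh0 Kh2; lra.
by apply: mulr_ge0 => //; apply: mulr_ge0 => //; apply: mulr_ge0 => //; apply: ltW.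
Qed.

(** The smallness of [t] is removed by dividing: [A t] is a power of [A (t / b.+1)], and the small
    case applies to the latter once [b] is large. *)
Lemma one_parameter_stable (R : realType) n m (A : C R -> 'M[C R]_n)
    (B : 'M[C R]_n) (U : 'M[C R]_(m, n)) (t : C R) :
  (forall s t, A (s + t) = A s *m A t) -> A 0 = 1%:M ->
  derivative_at0 A B -> (U *m B <= U)%MS -> (U *m A t <= U)%MS.
Proof.
move=> AD A0 A'0 /submxP[D UB].
set K := mxnorm1 B + mxnorm1 D + 1.
have K1 : 1 <= K by have := mxnorm1_ge0 B; have := mxnorm1_ge0 D; rewrite /K; lra.
have : 0 <= 2 * K * cabs t by apply: mulr_ge0; [lra | exact: cabs_ge0].
move=> /archi_boundP; set b := Num.bound _ => tb.
set h := t / b.+1%:R.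
have Uh : (U *m A h <= U)%MS.
  apply: (one_parameter_stable_small AD A0 A'0 UB); rewrite -/K.
  have th : cabs t = b.+1%:R * cabs h.
    by rewrite -[b.+1%:R]cabs_nat -cabsM mulrC divfK // pnatr_eq0.
  have bh : b%:R < b.+1%:R :> R by rewrite ltr_nat.
  rewrite -(ler_pM2l (_ : 0 < b.+1%:R)) // mulr1 mulrCA -th.
  exact: ltW (lt_trans tb bh).
suff Uj j : (U *m A (j%:R * h)%R <= U)%MS.
  by have := Uj b.+1; rewrite mulrC divfK // pnatr_eq0.
elim: j => [|j IHj]; first by rewrite mul0r A0 mulmx1.
rewrite -add1n natrD mulrDl mul1r AD mulmxA.
exact: submx_trans (submxMr _ Uh) IHj.
Qed.

(** * Differentials in charts *)

Lemma is_derive1P (K : numFieldType) (V : normedModType K) (f : K -> V) x v :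
  is_derive (x : K) (1 : K) f v <-> differentiable f x /\ 'd f x 1 = v.
Proof.
split=> [f'|[df fv]].
  have df : differentiable f x by apply/derivable1_diffP; case: f'.
  by split=> //; rewrite -deriveE //; case: f'.
by split; [exact/derivable1_diffP | rewrite deriveE].
Qed.

(** Expressions in charts agree only near the base point, where [param] inverts the chart. The
    first-order expansion does not see beyond such a neighbourhood. *)
Lemma near_eq_differentiable (K : numFieldType) (V W : normedModType K)
    (f g : V -> W) (x : V) :
  (\near x, f x = g x) -> differentiable f x ->
  differentiable g x /\ 'd g x = 'd f x :> (V -> W).
Proof.
move=> fg df; have fgx : f x = g x by exact: nbhs_singleton fg.
have dg : g \o shift x = cst (g x) + 'd f x +o_ 0 id.
  apply/eqaddoP => _/posnumP[e].
  have /diff_locally /eqaddoP /(_ e%:num) /(_ [gt0 of e%:num]) := df.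
  have : \forall h \near 0, f (h + x) = g (h + x).
    by move: fg; rewrite [X in X -> _](near_shift 0) /= subr0.
  apply: filterS2 => h /= fgh; rewrite -fgx.
  by rewrite -[X in _ -> `|X| <= _]/(g (h + x) - (f x + 'd f x h)) -fgh.
have cf := diff_continuous df.
have d_g := diff_unique cf dg.
by split=> //; apply/diff_locallyP; rewrite d_g.
Qed.

Definition mdifferentiable (R : realType) (n m : nat)
    (X : complexManifoldType R n) (Y : complexManifoldType R m)
    (f : X -> Y) (p : X) : Prop :=
  differentiable (in_charts f p) (chart_at p p).

Lemma near_dom (R : realType) (n : nat) (X : complexManifoldType R n) (p : X) :
  \forall q \near p, dom (chart_at p) q.
Proof. by apply: open_nbhs_nbhs; split; [exact: dom_open | exact: chart_at_dom]. Qed.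

Lemma paramK (R : realType) (n : nat) (X : complexManifoldType R n) (p : X) :
  param (chart_at p) (chart_at p p) = p.
Proof. by apply: coordK; apply: chart_at_dom. Qed.

Lemma near_coord (R : realType) (n : nat) (X : complexManifoldType R n) (p : X) :
  \forall w \near chart_at p p, (chart_at p @` dom (chart_at p)) w.
Proof.
apply: open_nbhs_nbhs; split; first exact: im_open.
by exists p => //; apply: chart_at_dom.
Qed.

Lemma param_cvg (R : realType) (n : nat) (X : complexManifoldType R n) (p : X) :
  param (chart_at p) @ chart_at p p --> p.
Proof.
rewrite -[X in _ --> X]paramK; apply: param_continuous.
by exists p => //; apply: chart_at_dom.
Qed.

(** The chain rule through the chart at [p]. Continuity of [c] is a separate hypothesis: it keeps
    [c] inside the chart domain near [s]. The source [V] serves both for complex time and for the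
    chart space of another manifold. *)
Lemma curve_comp (R : realType) (n m : nat) (X : complexManifoldType R n)
    (Y : complexManifoldType R m) (V : normedModType (C R)) (f : X -> Y)
    (c : V -> X) (s : V) (p : X) :
  c s = p -> {for s, continuous c} -> differentiable (chart_at p \o c) s ->
  mdifferentiable f p ->
  differentiable (chart_at (f p) \o f \o c) s /\
  'd (chart_at (f p) \o f \o c) s =
    mdiff f p \o 'd (chart_at p \o c) s :> (V -> _).
Proof.
move=> <- cc dc df.
have dfc : differentiable (in_charts f (c s) \o (chart_at (c s) \o c)) s.
  exact: differentiable_comp.
set g := chart_at _ \o _ \o c.
have [|dg ->] := @near_eq_differentiable _ _ _ _ g _ _ dfc; last first.
  by split=> //; rewrite diff_comp.
have : \forall t \near s, dom (chart_at (c s)) (c t) by apply: cc (near_dom _).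
by apply: filterS => t dct; rewrite /in_charts /= coordK.
Qed.

Lemma mdiff_comp (R : realType) (n m k : nat) (X : complexManifoldType R n)
    (Y : complexManifoldType R m) (Z : complexManifoldType R k)
    (f : X -> Y) (g : Y -> Z) (p : X) :
  {for p, continuous f} -> mdifferentiable f p -> mdifferentiable g (f p) ->
  mdifferentiable (g \o f) p /\ mdiff (g \o f) p = mdiff g (f p) \o mdiff f p.
Proof.
move=> fc df dg.
have fpc : {for chart_at p p, continuous (f \o param (chart_at p))}.
  rewrite /prop_for /continuous_at /= paramK.
  exact: cvg_comp (@param_cvg _ _ _ p) fc.
exact: (curve_comp (congr1 f (paramK p)) fpc df dg).
Qed.

Lemma mdiff_id (R : realType) (n : nat) (X : complexManifoldType R n) (p : X) :
  mdiff (fun x : X => x) p = id.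
Proof.
have di : differentiable (id : 'rV[C R]_n -> _) (chart_at p p) by [].
have [|_ e] := @near_eq_differentiable _ _ _ _ (in_charts (fun x : X => x) p) _ _ di.
  have := near_coord p.
  by apply: filterS => w [q dq <-]; rewrite /in_charts /= coordK.
by rewrite /mdiff e diff_val.
Qed.

(** * The adjoint representation *)

Section LieGroup.
Variables (R : realType) (n : nat) (G : complexLieGroupType R n).
Implicit Types g h : G.

Lemma mulg_cvg (T : Type) (F : set_system T) (FF : Filter F) (a b : T -> G) g h :
  a @ F --> g -> b @ F --> h -> (fun x => (a x * b x)%g) @ F --> (g * h)%g.
Proof.
move=> ag bh; have [mc _] := mulg_holo g h.
exact: (@cvg_comp _ _ _ (fun x => (a x, b x)) _ _ _ _ (cvg_pair ag bh) mc).
Qed.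

Definition mul_charts g h (w : 'rV[C R]_n * 'rV[C R]_n) : 'rV[C R]_n :=
  chart_at (g * h)%g (param (chart_at g) w.1 * param (chart_at h) w.2)%g.

Lemma mul_charts_differentiable g h :
  differentiable (mul_charts g h) (chart_at g g, chart_at h h).
Proof. by have [_ [W [_ Wgh]] /(_ 1) [d1 _]] := mulg_holo g h; apply: d1. Qed.

Lemma ltrans_differentiable g h : mdifferentiable (fun x => (g * x)%g) h.
Proof.
rewrite /mdifferentiable.
have -> : in_charts (fun x => (g * x)%g) h =
    mul_charts g h \o (fun w => (chart_at g g, w)).
  by apply/funext => w; rewrite /mul_charts /in_charts /= paramK.
apply: differentiable_comp; first exact: differentiable_pair.
exact: mul_charts_differentiable.
Qed.

Lemma rtrans_differentiable g h : mdifferentiable (fun x => (x * g)%g) h.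
Proof.
rewrite /mdifferentiable.
have -> : in_charts (fun x => (x * g)%g) h =
    mul_charts h g \o (fun w => (w, chart_at g g)).
  by apply/funext => w; rewrite /mul_charts /in_charts /= paramK.
apply: differentiable_comp; first exact: differentiable_pair.
exact: mul_charts_differentiable.
Qed.

Lemma conjg_continuous g h : {for h, continuous (fun x => (g * x * g^-1)%g)}.
Proof.
apply: mulg_cvg; last exact: cvg_cst.
by apply: mulg_cvg; [exact: cvg_cst | exact: cvg_id].
Qed.

Lemma conjg_differentiable g h : mdifferentiable (fun x => (g * x * g^-1)%g) h.
Proof.
have [|//] := @mdiff_comp _ _ _ _ _ _ _ (fun x => (g * x)%g)
  (fun x => (x * g^-1)%g) h _ (@ltrans_differentiable g h)
  (@rtrans_differentiable g^-1%g (g * h)%g).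
by apply: mulg_cvg; [exact: cvg_cst | exact: cvg_id].
Qed.

Lemma Ad1 : Ad (1%g : G) = id.
Proof.
rewrite /Ad -(mdiff_id (1%g : G)); congr mdiff; apply/funext => x.
by rewrite mul1g invg1 mulg1.
Qed.

Lemma AdM g h : Ad (g * h)%g = Ad g \o Ad h.
Proof.
have e : (h * 1 * h^-1 = 1)%g by rewrite mulg1 mulgV.
have [_] := @mdiff_comp _ _ _ _ _ _ _ (fun x => (h * x * h^-1)%g)
  (fun x => (g * x * g^-1)%g) 1%g (@conjg_continuous h 1%g)
  (@conjg_differentiable h 1%g) (@conjg_differentiable g _).
rewrite {1}e => <-; rewrite /Ad; congr mdiff; apply/funext => x /=.
by rewrite invgM !mulgA.
Qed.

Lemma one_parameter0 (c : C R -> G) :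
  (forall s t, c (s + t) = (c s * c t)%g) -> c 0 = 1%g.
Proof. by move=> cD; apply: (@mulgI _ (c 0)); rewrite -cD addr0 mulg1. Qed.

(** The curve [f \o c] is again a one-parameter subgroup, and the chain rule at time 0 gives its
    initial velocity. *)
Lemma is_exp_morph (f : G -> G) X g :
  (forall x y, f (x * y)%g = (f x * f y)%g) -> continuous f ->
  mdifferentiable f 1%g -> is_exp X g -> is_exp (mdiff f 1%g X) (f g).
Proof.
move=> fM fc df [c [cD cc c'X <-]].
have f1 : f 1%g = 1%g by apply: (@mulgI _ (f 1%g)); rewrite -fM !mulg1.
have c0 := one_parameter0 cD.
exists (f \o c); split => //.
- by move=> s t /=; rewrite cD fM.
- by move=> t; apply: continuous_comp; [exact: cc | exact: fc].
have /is_derive1P[dc dX] := c'X.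
have [d1 d2] := curve_comp c0 (cc 0) dc df.
rewrite f1 in d1 d2.
by apply/is_derive1P; rewrite d2 /= dX.
Qed.

Lemma is_exp_conj g X x : is_exp X x -> is_exp (Ad g X) (g * x * g^-1)%g.
Proof.
apply: (@is_exp_morph (fun x => (g * x * g^-1)%g)).
- by move=> y z; rewrite !mulgA mulgVK.
- exact: conjg_continuous.
exact: conjg_differentiable.
Qed.

End LieGroup.

(** * Differentiability of the adjoint representation at the unit *)

Lemma linear_pair_row_sum (K : comNzRingType) (n : nat) (V W : lmodType K)
    (f : {linear ('rV[K]_n * V)%type -> W}) (x : 'rV[K]_n) :
  f (x, 0) = \sum_i x 0 i *: f (delta_mx 0 i, 0).
Proof.
rewrite {1}[x]row_sum_delta.
have -> : (\sum_j x 0 j *: delta_mx 0 j, 0 : V) =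
    \sum_j x 0 j *: (delta_mx 0 j : 'rV[K]_n, 0 : V).
  elim/big_rec2: _ => // i y1 y2 _ <-.
  by congr (_, _); rewrite /= scaler0 addr0.
by rewrite linear_sum; apply: eq_bigr => i _; rewrite linearZ.
Qed.

Section AdjointDerivative.
Variables (R : realType) (n : nat) (G : complexLieGroupType R n).

Let e := chart_at (1%g : G) 1%g.
Let prm : 'rV[C R]_n -> G := param (chart_at (1%g : G)).
Let L := mul_charts (1%g : G) 1%g.
Let iota (w : 'rV[C R]_n) : 'rV[C R]_n := chart_at (1%g : G) (prm w)^-1%g.

Lemma param_chart1 : prm e = 1%g.
Proof. exact: paramK. Qed.

Lemma iota_differentiable : differentiable iota e.
Proof.
have [_ [W [_ We] /(_ 1) [d1 _]]] := invg_holo (1%g : G).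
by have := d1 _ We; rewrite /in_charts invg1.
Qed.

Lemma iota_chart1 : iota e = e.
Proof. by rewrite /iota param_chart1 invg1. Qed.

Lemma invg_prm_cvg : (fun w => (prm w)^-1%g) @ e --> (1%g : G).
Proof.
have [ic _] := invg_holo (1%g : G); rewrite /prop_for /continuous_at invg1 in ic.
exact: cvg_comp (@param_cvg _ _ G 1%g) ic.
Qed.

(* Conjugation by [param w] reads [v |-> L (L (w, v), iota w)] in the chart at 1.
   Differentiating in [v] expresses Ad through the partial derivatives of [L],
   which are again differentiable in [w]; hence [bracket] is not a junk value. *)
Lemma Ad_in_charts (Y : 'rV[C R]_n) :
  \forall w \near e, Ad (prm w) Y = 'd L (w, iota w) ('d L (w, e) (0, Y), 0).
Proof.
have [_ [W [Wo We] /(_ 1) [dL _]]] := mulg_holo (1%g : G) 1%g.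
have [i1 i2] := (iota_differentiable, iota_chart1).
have near1 : \forall w \near e, W (w, e).
  have : {for e, continuous (fun w : 'rV[C R]_n => (w, e))}.
    by apply: differentiable_continuous; apply: differentiable_pair.
  by move=> /(_ W); apply; apply: open_nbhs_nbhs; split.
have near2 : \forall w \near e, W (w, iota w).
  have : {for e, continuous (fun w : 'rV[C R]_n => (w, iota w))}.
    by apply: differentiable_continuous; apply: differentiable_pair.
  rewrite /prop_for /continuous_at i2 => /(_ W); apply.
  by apply: open_nbhs_nbhs; split.
have near3 : \forall w \near e, dom (chart_at (1%g : G)) (prm w)^-1%g.
  by apply: invg_prm_cvg; apply: near_dom.
near=> w.
have [g [pw dg gw]] : exists g : G, [/\ prm w = g, dom (chart_at (1%g : G)) g
    & chart_at (1%g : G) g = w].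
  have [g dg gw] : (chart_at (1%g : G) @` dom (chart_at (1%g : G))) w.
    by near: w; apply: near_coord.
  by exists g; split=> //; rewrite -gw /prm coordK.
have L1 : W (w, e) by near: w.
have L2 : W (w, iota w) by near: w.
have gi : dom (chart_at (1%g : G)) (g^-1)%g by rewrite -pw; near: w.
have pi : prm (iota w) = (g^-1)%g by rewrite /iota pw /prm coordK.
(* The chart point [e] stands for the unit, so the outer derivative of [L] is taken at
   [(w, iota w)]. *)
have Lwe : L (w, e) = w.
  by rewrite /L /mul_charts /= -/(prm w) -/(prm e) param_chart1 pw !mulg1 gw.
pose P1 (v : 'rV[C R]_n) := (w, v); pose P2 (v : 'rV[C R]_n) := (v, iota w).
have dP1 : is_diff e P1 (fun v => (0, v)).
  exact: (is_diff_pair (is_diff_cst w e) (is_diff_id e)).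
have dP2 : is_diff w P2 (fun v => (v, 0)).
  exact: (is_diff_pair (is_diff_id w) (is_diff_cst (iota w) w)).
have dL1 : is_diff (P1 e) L ('d L (w, e)) by apply/differentiableP/dL.
have dL2 : is_diff (P2 w) L ('d L (w, iota w)) by apply/differentiableP/dL.
have d1 := is_diff_comp dP1 dL1.
have dP2' : is_diff ((L \o P1) e) P2 (fun v => (v, 0)) by rewrite /= Lwe.
have d2 := is_diff_comp d1 dP2'.
have dL2' : is_diff ((P2 \o (L \o P1)) e) L ('d L (w, iota w)) by rewrite /= Lwe.
have d3 := is_diff_comp d2 dL2'.
have [|_ Ed] := @near_eq_differentiable _ _ _ _
  (in_charts (fun x => (g * x * g^-1)%g) 1%g) _ _ (@ex_diff _ _ _ _ _ _ _ d3).
  (* Reading [g * prm v] in the chart at 1 and back is harmless only inside the chart domain; this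
     holds for [v] near [e] because [g] lies there. *)
  have : \forall v \near e, dom (chart_at (1%g : G)) (g * prm v)%g.
    have : (fun v => (g * prm v)%g) @ e --> (g * 1)%g.
      have p1 : prm @ e --> (1%g : G) by exact: param_cvg.
      have p2 : (fun _ : 'rV[C R]_n => g) @ e --> g.
        exact: (@cvg_cst G g _ (nbhs e) (nbhs_filter e)).
      exact: (@mulg_cvg R n G _ (nbhs e) (nbhs_filter e) (fun=> g) prm g 1%g p2 p1).
    move=> /(_ (dom (chart_at (1%g : G)))); apply; rewrite mulg1.
    by apply: open_nbhs_nbhs; split=> //; apply: dom_open.
  apply: filterS => v dv.
  rewrite /in_charts /= /L /mul_charts /= -/(prm w) -/(prm v) -/(prm (iota w)).
  by rewrite !mulg1 pw pi coordK // mulgV.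
by rewrite pw /Ad /mdiff Ed diff_val.
Unshelve. all: by end_near. Qed.

Lemma Ad_differentiable (Y : 'rV[C R]_n) :
  differentiable (fun w => Ad (prm w) Y) e.
Proof.
(* Class C^2 is required here: the first derivatives of [L] must themselves be differentiable. *)
have [_ [W [Wo We] /(_ 2) [dL dL']]] := mulg_holo (1%g : G) 1%g.
have [i1 i2] := (iota_differentiable, iota_chart1).
have near1 : \forall w \near e, W (w, e).
  have : {for e, continuous (fun w : 'rV[C R]_n => (w, e))}.
    by apply: differentiable_continuous; apply: differentiable_pair.
  by move=> /(_ W); apply; apply: open_nbhs_nbhs; split.
have near2 : \forall w \near e, W (w, iota w).
  have : {for e, continuous (fun w : 'rV[C R]_n => (w, iota w))}.
    by apply: differentiable_continuous; apply: differentiable_pair.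
  rewrite /prop_for /continuous_at i2 => /(_ W); apply.
  by apply: open_nbhs_nbhs; split.
pose a w := 'D_(0, Y) L (w, e).
pose b (i : 'I_n) w := 'D_(delta_mx 0 i, 0) L (w, iota w).
have DL v : differentiable ('D_v L) (e, e) by have [/(_ _ We)] := dL' v.
have dP1 : differentiable (fun w : 'rV[C R]_n => (w, e)) e.
  exact: differentiable_pair.
have dP2 : differentiable (fun w : 'rV[C R]_n => (w, iota w)) e.
  exact: differentiable_pair.
have da : differentiable a e by exact: differentiable_comp dP1 (DL _).
have db i : differentiable (b i) e.
  have D2 : differentiable ('D_(delta_mx 0 i, 0) L) (e, iota e) by rewrite i2.
  exact: differentiable_comp dP2 D2.
have dc (f : 'rV[C R]_n -> 'rV[C R]_n) j : differentiable f e ->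
    differentiable (fun w => f w 0 j : C R) e.
  by move=> df; exact: differentiable_comp df (differentiable_coord (f e) 0 j).
(* The sum of the [a w 0 i *: b i w], expanded in entries so that the product rule is applied to
   scalar functions. *)
pose F := \sum_i \sum_j
  ((fun w => a w 0 i * b i w 0 j *: delta_mx 0 j) : 'rV[C R]_n -> 'rV[C R]_n).
have dF : differentiable F e.
  apply: differentiable_sum => i; apply: differentiable_sum => j.
  apply: differentiableZl.
  have da' := dc _ i da; have db' := dc _ j (db i).
  exact: differentiableM da' db'.
have [|//] := @near_eq_differentiable _ _ _ _ (fun w => Ad (prm w) Y) _ _ dF.
have := Ad_in_charts Y.
apply: filterS3 near1 near2 => w W1 W2 ->; apply/esym.
have L1 : differentiable L (w, e) by apply: dL.
have L2 : differentiable L (w, iota w) by apply: dL.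
have aE : 'd L (w, e) (0, Y) = a w.
  exact: esym (@deriveE _ _ _ L (w, e) (0, Y) L1).
have bE i : 'd L (w, iota w) (delta_mx 0 i, 0) = b i w.
  exact: esym (@deriveE _ _ _ L (w, iota w) (delta_mx 0 i, 0) L2).
have FE : F w = \sum_i a w 0 i *: b i w.
  rewrite /F fct_sumE; apply: eq_bigr => i _.
  rewrite fct_sumE [X in _ *: X]row_sum_delta scaler_sumr.
  by apply: eq_bigr => j _; rewrite scalerA.
rewrite FE.
have E1 : 'd L (w, iota w) ('d L (w, e) (0, Y), 0) = 'd L (w, iota w) (a w, 0).
  refine (congr1 (fun x : 'rV[C R]_n => 'd L (w, iota w) (x, 0 : 'rV[C R]_n)) aE).
(* The direction [(a w, 0)] moves with [w]; expanding it leaves only derivatives of [L] in fixed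
   directions. *)
have E2 := linear_pair_row_sum ('d L (w, iota w)) (a w).
refine (etrans E1 (etrans E2 _)).
by apply: eq_bigr => i _; exact: (congr1 (fun x => a w 0 i *: x) (bE i)).
Qed.

End AdjointDerivative.

(** * Subspaces and subgroups stable under the adjoint action *)

Lemma norm_entry_le (K : numDomainType) m n (A : 'M[K]_(m, n)) i j :
  `|A i j| <= `|A|.
Proof.
rewrite [leRHS]/Num.norm /= mx_normE -[leLHS]nngE num_le.
exact: (@le_bigmax _ _ _ _ (fun ij : 'I_m * 'I_n => `|A ij.1 ij.2|%:nng) (i, j)).
Qed.

Section AdjointInvariance.
Variables (R : realType) (n : nat) (G : complexLieGroupType R n).
Implicit Types g h : G.

Lemma bracket_derive (X Y : 'rV[C R]_n) : bracket G X Y =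
  'D_X (fun w => Ad (param (chart_at (1%g : G)) w) Y) (chart_at (1%g : G) 1%g).
Proof. exact: esym (deriveE X (@Ad_differentiable _ _ G Y)). Qed.

Lemma Ad_sum_delta g (Y : 'rV[C R]_n) :
  Ad g Y = \sum_i Y 0 i *: Ad g (delta_mx 0 i).
Proof.
rewrite {1}[Y]row_sum_delta /Ad /mdiff linear_sum; apply: eq_bigr => i _.
by rewrite linearZ.
Qed.

Definition ad_mx (X : 'rV[C R]_n) : 'M[C R]_n :=
  \matrix_i bracket G X (delta_mx 0 i).

(** Linearity of [bracket] in its second argument: each [Ad g] is linear, and the derivative passes
    through the finite sum since every summand is differentiable. *)
Lemma ad_mxE (X Y : 'rV[C R]_n) : Y *m ad_mx X = bracket G X Y.
Proof.
rewrite bracket_derive mulmx_sum_row.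
have -> : (fun w => Ad (param (chart_at (1%g : G)) w) Y) =
  \sum_i (Y 0 i *: fun w => Ad (param (chart_at (1%g : G)) w) (delta_mx 0 i)).
  by apply/funext => w; rewrite fct_sumE Ad_sum_delta.
have dA i : derivable (fun w => Ad (param (chart_at (1%g : G)) w) (delta_mx 0 i))
    (chart_at (1%g : G) 1%g) X.
  exact: diff_derivable (@Ad_differentiable _ _ G _).
rewrite derive_sum => [|i]; last exact: derivableZ.
by apply: eq_bigr => i _; rewrite deriveZ // rowK bracket_derive.
Qed.

Definition Ad_mx g : 'M[C R]_n := lin1_mx (Ad g).

Lemma Ad_mxE g (Y : 'rV[C R]_n) : Y *m Ad_mx g = Ad g Y.
Proof. exact: mul_rV_lin1. Qed.

Lemma Ad_mx1 : Ad_mx (1%g : G) = 1%:M.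
Proof. by apply/row_matrixP => i; rewrite !rowE Ad_mxE Ad1 mulmx1. Qed.

Lemma Ad_mxM g h : Ad_mx (g * h)%g = Ad_mx h *m Ad_mx g.
Proof.
apply/row_matrixP => i; rewrite !rowE mulmxA; move: (delta_mx 0 i) => Y.
have -> : Y *m Ad_mx h *m Ad_mx g = Ad g (Ad h Y).
  by have -> := Ad_mxE h Y; exact: Ad_mxE.
by have -> := Ad_mxE (g * h)%g Y; have -> := AdM g h.
Qed.

(** Near time 0 the curve stays in the chart domain at 1, so [Ad (c t) Y] is the function
    differentiated in [bracket], composed with the curve read in the chart. *)
Lemma Ad_curve_differentiable (c : C R -> G) X Y :
  c 0 = 1%g -> continuous c ->
  is_derive (0 : C R) 1 (chart_at (1%g : G) \o c) X ->
  differentiable (fun t => Ad (c t) Y) 0 /\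
  'd (fun t => Ad (c t) Y) 0 1 = bracket G X Y.
Proof.
move=> c0 cc c'X.
have /is_derive1P[dc dX] := c'X.
have dA : differentiable (fun w => Ad (param (chart_at (1%g : G)) w) Y)
  ((chart_at (1%g : G) \o c) 0) by rewrite /= c0; exact: Ad_differentiable.
have d1 := differentiable_comp dc dA.
have [|d2 e] := @near_eq_differentiable _ _ _ _ (fun t => Ad (c t) Y) _ _ d1.
  have : \forall t \near 0, dom (chart_at (1%g : G)) (c t).
    by apply: cc; rewrite c0; apply: near_dom.
  by apply: filterS => t dt /=; rewrite coordK.
split; first exact: d2.
refine (etrans (congr1 (fun f : C R -> _ => f 1) (etrans e (diff_comp dc dA))) _).
refine (etrans (congr1 ('d _ _) dX) _).
by rewrite [X in 'd _ X]/= c0.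
Qed.

Lemma Ad_mx_derivative (c : C R -> G) X :
  c 0 = 1%g -> continuous c ->
  is_derive (0 : C R) 1 (chart_at (1%g : G) \o c) X ->
  derivative_at0 (fun t => Ad_mx (c t)) (ad_mx X).
Proof.
move=> c0 cc c'X eps e0.
(* The tolerance is shared among [n * n] entries; the successor avoids dividing by zero when
   [n = 0]. *)
pose e1 : R := eps / (n * n).+1%:R.
have e10 : 0 < e1 by rewrite divr_gt0.
have e1C : 0 < e1%:C%C by rewrite ltcR.
pose F t i := Ad (c t) (delta_mx 0 i) - delta_mx 0 i - t *: bracket G X (delta_mx 0 i).
have nearF i : \forall t \near (0 : C R), `|F t i| <= e1%:C%C * `|t|.
  have [d1 d2] := Ad_curve_differentiable (delta_mx 0 i) c0 cc c'X.
  set f := (fun t => Ad (c t) (delta_mx 0 i)) in d1 d2.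
  have dt t : 'd f 0 t = t *: bracket G X (delta_mx 0 i).
    by rewrite -d2 -linearZ; congr ('d _ _ _); exact: esym (mulr1 t).
  have /eqaddoP /(_ _ e1C) := diff_locally d1.
  apply: filterS => t; congr (`|_| <= _).
  rewrite /F -[LHS]/(f (t + 0) - (f 0 + 'd f 0 t)).
  by rewrite addr0 dt /f c0 Ad1 opprD addrA.
(* The radius [d] is an element of [C R]; being positive it is real and equals its modulus. *)
have /nbhs_ballP [d d0 Hd] := filter_forall (nbhs_filter 0) nearF.
have dE : d = (cabs d)%:C%C by rewrite -cabsE gtr0_norm.
exists (cabs d) => [|t td]; first by rewrite -ltcR -dE.
have {}Hd i : `|F t i| <= e1%:C%C * `|t|.
  by apply: Hd; rewrite -ball_normE /= sub0r normrN cabsE dE ltcR.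
have entry i j : cabs ((Ad_mx (c t) - 1%:M - t *: ad_mx X) i j) <= e1 * cabs t.
  rewrite -lecR rmorphM -!cabsE; apply: le_trans (Hd i).
  suff -> : (Ad_mx (c t) - 1%:M - t *: ad_mx X) i j = F t i 0 j.
    exact: norm_entry_le.
  have <- : row i (Ad_mx (c t) - 1%:M - t *: ad_mx X) = F t i.
    by rewrite rowE !mulmxBr mulmx1 -scalemxAr ad_mxE Ad_mxE.
  by rewrite [RHS]mxE.
apply: le_trans (_ : \sum_(i < n) \sum_(j < n) e1 * cabs t <= _).
  by apply: ler_sum => i _; apply: ler_sum => j _.
rewrite !sumr_const !card_ord -mulrnA -[X in X <= _]mulr_natr mulrAC.
apply: ler_wpM2r; first exact: cabs_ge0.
rewrite /e1 mulrAC ler_pdivrMr // ler_pM2l // ler_nat.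
by rewrite leqnSn.
Qed.


(** With [U] encoded as the row space of a matrix of basis vectors, stability under the bracket
    becomes the hypothesis of [one_parameter_stable]. *)
Lemma Ad_curve_stable (c : C R -> G) X (U : {vspace 'rV[C R]_n}) t :
  (forall s t, c (s + t) = (c s * c t)%g) -> continuous c ->
  is_derive (0 : C R) 1 (chart_at (1%g : G) \o c) X ->
  (forall Y, Y \in U -> bracket G X Y \in U) ->
  forall Y, Y \in U -> Ad (c t) Y \in U.
Proof.
move=> cD cc c'X XU Y YU; have c0 := one_parameter0 cD.
pose M : 'M[C R]_(\dim U, n) := \matrix_i (vbasis U)`_i.
have subM (Z : 'rV[C R]_n) : (Z <= M)%MS -> Z \in U.
  move=> /submxP[D ->]; rewrite mulmx_sum_row; apply: memv_suml => i _.
  by rewrite rowK memvZ // vbasis_mem // mem_nth ?size_tuple.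
have memM (Z : 'rV[C R]_n) : Z \in U -> (Z <= M)%MS.
  move=> ZU; apply/submxP; exists (\row_i coord (vbasis U) i Z).
  rewrite mulmx_sum_row {1}(coord_vbasis ZU).
  by apply: eq_bigr => i _; rewrite mxE rowK.
apply: (subM); rewrite -Ad_mxE.
apply: submx_trans (submxMr _ (memM _ YU)) _.
apply: (@one_parameter_stable _ _ _ (fun t => Ad_mx (c t)) (ad_mx X)).
(* [Ad_mx] acts on row vectors and so reverses products; exchanging the two times compensates. *)
- by move=> s r; rewrite addrC cD Ad_mxM.
- by rewrite c0 Ad_mx1.
- exact: Ad_mx_derivative.
apply/row_subP => i; rewrite row_mul ad_mxE; apply/memM/XU/subM/row_sub.
Qed.

Lemma connected_subgroup_Ad_stable (s U : {vspace 'rV[C R]_n}) h :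
  (forall X Y, X \in s -> Y \in U -> bracket G X Y \in U) ->
  connected_subgroup s h -> forall Y, Y \in U -> Ad h Y \in U.
Proof.
move=> sU hs.
(* The induction must carry the inverse along, for the case of [Sub_inv]. For an exponential the
   inverse is the same curve at time -1. *)
suff: (forall Y, Y \in U -> Ad h Y \in U) /\ (forall Y, Y \in U -> Ad (h^-1)%g Y \in U).
  by case.
elim: hs => {h} [X h Xs [c [cD cc c'X <-]]| |g h _ [g1 g2] _ [h1 h2]|g _ [g1 g2]].
- have -> : (c 1%R)^-1%g = c (-1).
    by apply: mulg1_eq; rewrite -cD subrr one_parameter0.
  have H t := @Ad_curve_stable c X U t cD cc c'X (fun Y => sU X Y Xs).
  by split; exact: H.
- by rewrite invg1; split=> Y YU; have -> := Ad1 G.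
- split=> Y YU; first by have -> := AdM g h; apply/g1/h1.
  by rewrite invgM; have -> := AdM h^-1%g g^-1%g; apply/h2/g2.
by rewrite invgK.
Qed.

(** Generators suffice for a homomorphism. Nothing analytic is asked of [f], so this serves both for
    conjugation by an element and for [Sigma]. *)
Lemma connected_subgroup_morph (s s' : {vspace 'rV[C R]_n}) (f : G -> G) g :
  (forall x y, f (x * y)%g = (f x * f y)%g) ->
  (forall X x, X \in s -> is_exp X x -> connected_subgroup s' (f x)) ->
  connected_subgroup s g -> connected_subgroup s' (f g).
Proof.
move=> fM fexp.
have f1 : f 1%g = 1%g by apply: (@mulgI _ (f 1%g)); rewrite -fM !mulg1.
have fV x : f (x^-1)%g = (f x)^-1%g.
  by apply/esym/mulg1_eq; rewrite -fM mulgV f1.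
elim=> [X x Xs xX| |x y _ IHx _ IHy|x _ IHx]; first exact: fexp xX.
- by rewrite f1; apply: Sub_one.
- by rewrite fM; apply: Sub_mul.
by rewrite fV; apply: Sub_inv.
Qed.

(** Conjugation by [h] sends exp X to exp (Ad h X), and [Ad h] preserves [U]. It is meant for [s] of
    degree 0 and [U] one of [n_minus d], [n_plus d]. *)
Lemma connected_subgroup_conj (s U : {vspace 'rV[C R]_n}) h g :
  (forall X Y, X \in s -> Y \in U -> bracket G X Y \in U) ->
  connected_subgroup s h -> connected_subgroup U g ->
  connected_subgroup U (h * g * h^-1)%g.
Proof.
move=> sU hs.
apply: (@connected_subgroup_morph _ _ (fun x => (h * x * h^-1)%g)).
  by move=> x y; rewrite !mulgA mulgVK.
move=> X x XU xX; apply: (@Sub_exp _ _ _ _ (Ad h X)).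
  exact: connected_subgroup_Ad_stable sU hs _ XU.
exact: is_exp_conj.
Qed.

End AdjointInvariance.

(** * The conjugation *)

Section Conjugation.
Variables (R : realType) (n : nat) (G : complexLieGroupType R n).

Lemma norm_conjv (m : nat) (w : 'rV[C R]_m) : `|conjv w| = `|w|.
Proof.
rewrite /Num.norm /= !mx_normE; congr (_%:num).
by apply: eq_bigr => i _; apply: val_inj; rewrite /= mxE norm_conjC.
Qed.

Lemma conjvB (m : nat) (v w : 'rV[C R]_m) : conjv (v - w) = conjv v - conjv w.
Proof. by apply/rowP => j; rewrite !mxE rmorphB. Qed.

Lemma conjvK (m : nat) : involutive (@conjv R m).
Proof. by move=> w; apply/rowP => j; rewrite !mxE conjCK. Qed.

Lemma conjvZ (m : nat) (a : C R) (w : 'rV[C R]_m) :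
  conjv (a *: w) = Num.conj a *: conjv w.
Proof. by apply/rowP => j; rewrite !mxE rmorphM. Qed.

Lemma conjC_continuous : continuous (Num.conj : C R -> C R).
Proof.
move=> x A /nbhs_ballP[e e0 eA]; apply/nbhs_ballP; exists e => //= t.
rewrite -ball_normE /= => te; apply: eA.
by rewrite -ball_normE /= -rmorphB norm_conjC.
Qed.

Lemma conj_dnbhs0 : (Num.conj : C R -> C R) @ (0 : C R)^' --> (0 : C R)^'.
Proof.
move=> A /nbhs_ballP[e e0 eA]; apply/nbhs_ballP; exists e => //= t te t0.
apply: eA; last by rewrite conjC_eq0.
by move: te; rewrite -!ball_normE /= !sub0r !normrN norm_conjC.
Qed.

(** Conjugating both time and value restores complex linearity: the new difference quotient at [h]
    is the conjugate of the old one at the conjugate of [h]. *)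
Lemma is_derive_conj (m : nat) (k : C R -> 'rV[C R]_m) (v : 'rV[C R]_m) :
  is_derive (0 : C R) 1 k v ->
  is_derive (0 : C R) 1 (@conjv R m \o k \o Num.conj) (conjv v).
Proof.
move=> k'; have dk := @ex_derive _ _ _ _ _ _ _ k'.
have kv : (fun h : C R => h^-1 *: ((k \o shift 0) (h *: 1) - k 0)) @ 0^' --> v.
  by rewrite -(@derive_val _ _ _ _ _ _ _ k'); exact: dk.
have kcv : (fun h : C R => h^-1 *: (((@conjv R m \o k \o Num.conj) \o shift 0) (h *: 1)
    - (@conjv R m \o k \o Num.conj) 0)) @ 0^' --> conjv v.
  apply/cvgrPdist_lt => e e0.
  have /cvgrPdist_lt /(_ e e0) /conj_dnbhs0 H := kv.
  have {}H : (0 : C R)^' [set h | `|v - (Num.conj h)^-1 *: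
      (k (Num.conj h *: (1 : C R) + 0) - k 0)| < e] by exact: H.
  apply: filterS H => h /=; rewrite -[X in _ -> `|X| < _]conjvK norm_conjv.
  rewrite !(conjvB, conjvZ, conjvK) fmorphV /= rmorph0 !addr0.
  by rewrite -![_ *: 1]/(_ * 1) !mulr1.
split; first by apply/cvg_ex; exists (conjv v).
exact: cvg_lim kcv.
Qed.

(** The curve [f \o c] is antiholomorphic in time, so it is precomposed with conjugation; its value
    at time 1 is unaffected because 1 is real. *)
Lemma is_exp_antiholo (f : G -> G) X g :
  (forall x y, f (x * y)%g = (f x * f y)%g) -> (forall x, antiholo_at f x) ->
  is_exp X g -> is_exp (amdiff f 1%g X) (f g).
Proof.
move=> fM fa [c [cD cc c'X <-]].
have f1 : f 1%g = 1%g by apply: (@mulgI _ (f 1%g)); rewrite -fM !mulg1.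
have c0 := one_parameter0 cD.
exists (f \o c \o Num.conj); split; last by rewrite /= conjC1.
- by move=> s t /=; rewrite rmorphD cD fM.
- move=> t; apply: continuous_comp; first exact: conjC_continuous.
  by apply: continuous_comp; [exact: cc | have [] := fa (c (Num.conj t))].
have [_ [W [_ W1] /(_ 1) [dF _]]] := fa 1%g.
have {dF W1} dF := dF _ W1.
have /is_derive1P[dc dX] := c'X.
have dF' : differentiable (@conjv R n \o in_charts f 1%g) ((chart_at (1%g : G) \o c) 0).
  by rewrite [X in differentiable _ X]/= c0.
have d1 := differentiable_comp dc dF'.
have [|d2 e] := @near_eq_differentiable _ _ _ _
  (@conjv R n \o chart_at (1%g : G) \o f \o c) _ _ d1.
  have : \forall t \near 0, dom (chart_at (1%g : G)) (c t).
    by apply: cc; rewrite c0; apply: near_dom.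
  by apply: filterS => t dt; rewrite /in_charts /= coordK // f1.
have k' : is_derive (0 : C R) 1 (@conjv R n \o chart_at (1%g : G) \o f \o c)
    ('d (@conjv R n \o in_charts f 1%g) (chart_at (1%g : G) 1%g) X).
  apply/is_derive1P; split; first exact: d2.
  refine (etrans (congr1 (fun f : C R -> _ => f 1) (etrans e (diff_comp dc dF'))) _).
  refine (etrans (congr1 ('d _ _) dX) _).
  by rewrite [X in 'd _ X]/= c0.
have := is_derive_conj k'.
rewrite -/(amdiff f 1%g X); congr (is_derive _ _ _ _).
by apply/funext => t /=; rewrite conjvK.
Qed.

End Conjugation.

(** * The gradation, the conjugation and matrix elements between fixed vectors *)

Section Gradation.
Variables (R : realType) (n : nat) (G : complexLieGroupType R n).
Variable d : gradation G.

Lemma bracket_sumr (I : finType) (X : 'rV[C R]_n) (Y : I -> 'rV[C R]_n) :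
  bracket G X (\sum_i Y i) = \sum_i bracket G X (Y i).
Proof.
by rewrite -ad_mxE mulmx_suml; apply: eq_bigr => i _; rewrite ad_mxE.
Qed.

Lemma bracket_n_plus (X Y : 'rV[C R]_n) :
  X \in d 0 -> Y \in n_plus d -> bracket G X Y \in n_plus d.
Proof.
move=> X0 /memv_sumP[Z Zd ->]; rewrite bracket_sumr; apply: memv_sumr => i _.
by have := gr_bracket X0 (Zd i isT); rewrite add0r.
Qed.

Lemma bracket_n_minus (X Y : 'rV[C R]_n) :
  X \in d 0 -> Y \in n_minus d -> bracket G X Y \in n_minus d.
Proof.
move=> X0 /memv_sumP[Z Zd ->]; rewrite bracket_sumr; apply: memv_sumr => i _.
by have := gr_bracket X0 (Zd i isT); rewrite add0r.
Qed.

Lemma Sigma_N_minus (sigma : 'rV[C R]_n -> 'rV[C R]_n) (Sigma : G -> G) g :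
  is_conjugation d sigma Sigma -> N_minus d g -> N_plus d (Sigma g).
Proof.
move=> conj; apply: connected_subgroup_morph (Sigma_mul conj) _ => X x XN xX.
apply: (@Sub_exp _ _ _ _ (sigma X)); last first.
  rewrite -(Sigma_sigma conj).
  exact: is_exp_antiholo (Sigma_mul conj) (Sigma_antiholo conj) xX.
have sD Y Z : sigma (Y + Z) = sigma Y + sigma Z.
  by have := sigma_antilinear conj 1 Y Z; rewrite conjC1 !scale1r.
have s0 : sigma 0 = 0.
  by apply: (addrI (sigma 0)); rewrite -sD !addr0.
case/memv_sumP: XN => Z Zd ->.
have -> : sigma (\sum_i Z i) = \sum_i sigma (Z i).
  by apply: (big_morph sigma sD s0).
(* The degree [i + 1] is written as a double opposite so that [sigma_gr] applies with
   [m = -(i + 1)]. *)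
apply: memv_sumr => i _; rewrite -[Posz i.+1]opprK.
have : (sigma @` [set X | X \in d (- i.+1%:Z)]) (sigma (Z i)).
  by exists (Z i) => //; apply: Zd.
by rewrite (sigma_gr conj).
Qed.

End Gradation.

(** Unitarity moves [rho g] to the other side as [rho (star Sigma g)], and
    [star Sigma g = Sigma (g^-1)] lies in [N_plus d], which fixes [u]. *)
Lemma rho_star_fixed (R : realType) (n : nat) (G : complexLieGroupType R n)
  (d : gradation G) (sigma : 'rV[C R]_n -> 'rV[C R]_n) (Sigma : G -> G)
  (V : lmodType (C R)) (form : {dot V for (@Num.conj (C R))})
  (rho : G -> {linear V -> V}) (u w : V) (g : G) :
  is_conjugation d sigma Sigma -> Sigma_unitary Sigma form rho ->
  V_plus d rho u -> N_minus d g -> form u (rho g w) = form u w.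
Proof.
move=> conj unit uP gN; rewrite -unit uP //.
by apply: Sigma_N_minus conj _; apply: Sub_inv.
Qed.

Theorem theorem3p1 (R : realType) (n : nat) (G : complexLieGroupType R n)
  (G_connected : connected [set: G]) (G_semisimple : semisimple G)
  (d : gradation G)
  (xm xp : 'rV[C R]_n)
  (xm_deg : xm \in d (-1)) (xm_neq0 : xm != 0)
  (xp_deg : xp \in d 1) (xp_neq0 : xp != 0)
  (km kp : nat)
  (Fm : complexManifoldType R km) (Fp : complexManifoldType R kp)
  (pim : G -> Fm) (pip : G -> Fp)
  (pim_quotient : is_quotient (B_plus d) pim)
  (pip_quotient : is_quotient (B_minus d) pip)
  (sigma : 'rV[C R]_n -> 'rV[C R]_n) (Sigma : G -> G)
  (Sigma_conj : is_conjugation d sigma Sigma)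
  (M : complexManifoldType R 1) (phi : M -> G)
  (phi_admissible : admissible d xm xp pim pip phi)
  (z : chart R 1 M) (gm gp : G)
  (mum mup num nup etam etap gamm gamp : M -> G)
  (loc : local_data d xm xp phi z gm gp mum mup num nup etam etap gamm gamp)
  (V : lmodType (C R)) (form : {dot V for (@Num.conj (C R))})
  (rho : G -> {linear V -> V})
  (rho_rep : representation rho) (rho_unitary : Sigma_unitary Sigma form rho)
  (gamma : M -> G)
  (gammaE : forall p, gamma p = ((gamp p)^-1 * etam p * (etap p)^-1 * gamm p)%g)
  (u v : V) (u_plus : V_plus d rho u) (v_plus : V_plus d rho v)
  (p : M) (p_dom : dom z p) :
  form u (rho (gamma p) v) =
  form u (rho ((mup p * gamp p)^-1 * (mum p * gamm p))%g v).
Proof.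
have [rho1 rhoM] := rho_rep.
have [num_N nup_N] := loc_nu loc p_dom.
have [gamm_H gamp_H] := loc_gamma loc p_dom.
have [phi_plus phi_minus] := loc_decomp loc p_dom.
have -> : ((mup p * gamp p)^-1 * (mum p * gamm p))%g =
    ((gamp p)^-1 * num p * gamp p * (gamma p * ((gamm p)^-1 * (nup p)^-1 * gamm p)))%g.
  (* The equality of the two decompositions of [phi p] is solved for [mum p]. *)
  have -> : mum p = (mup p * num p * etam p * (etap p)^-1 * (nup p)^-1)%g.
    by rewrite -phi_plus phi_minus !mulgK.
  by rewrite gammaE invgM !mulgA mulgVK !mulgK.
rewrite rhoM (rhoM (gamma p)).
have nu_minus : N_minus d ((gamp p)^-1 * num p * gamp p)%g.
  have := connected_subgroup_conj (@bracket_n_minus _ _ _ d) (Sub_inv gamp_H) num_N.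
  by rewrite invgK.
have nu_plus : N_plus d ((gamm p)^-1 * (nup p)^-1 * gamm p)%g.
  have := connected_subgroup_conj (@bracket_n_plus _ _ _ d)
    (Sub_inv gamm_H) (Sub_inv nup_N).
  by rewrite invgK.
by rewrite (rho_star_fixed _ Sigma_conj rho_unitary u_plus nu_minus) (v_plus _ nu_plus).
Qed.
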